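(* The following proof system is sound and strongly complete for $\textbf{EDG}$ with respect to the class of all dependence epistemic models (i.e. for every set $\Gamma$ of $\textbf{EDG}$-formulas and formula $\phi$, $\Gamma\vdash\phi$ iff $\phi$ is true at every pointed model satisfying all of $\Gamma$): all instances of propositional tautologies; modus ponens; for each $\Box\in\{\mathcal{K},\mathcal{A}\}$: necessitation (from $\phi$ infer $\Box\phi$), $\Box(\phi\to\psi)\to(\Box\phi\to\Box\psi)$, $\Box\phi\to\phi$, $\Box\phi\to\Box\Box\phi$, $\neg\Box\phi\to\Box\neg\Box\phi$; axiom Q: $\mathcal{D}_g(X,Y)\leftrightarrow\bigvee_{X'\subseteq X,\,Y'\subseteq Y,\,X'\neq\emptyset,\,Y'\neq\emptyset}\mathcal{Q}(X'\cup Y')$ for nonempty finite $X,Y\subseteq\mathbb{V}$; axiom E: $\mathcal{D}_g(\emptyset,X)\leftrightarrow\mathcal{D}_g(X,\emptyset)\leftrightarrow\bot$; axiom 4 for $\mathcal{D}_g$: $\mathcal{D}_g(X,Y)\to\mathcal{A}\mathcal{D}_g(X,Y)$.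
   Context: Fix countable sets $\mathbb{P}$ (propositions) and $\mathbb{V}$ (variables). $\textbf{EDG}$ formulas: $\phi::=\top\mid p\mid\neg\phi\mid(\phi\land\phi)\mid\mathcal{K}\phi\mid\mathcal{A}\phi\mid\mathcal{D}_g(X,Y)$ with $p\in\mathbb{P}$ and $X,Y$ finite subsets of $\mathbb{V}$; $\bot,\lor,\to,\leftrightarrow$ defined as usual. For nonempty finite $W\subseteq\mathbb{V}$, $\mathcal{Q}(W)$ denotes $\mathcal{D}_g(W,W)$ if $|W|=1$, and $\bigwedge_{\emptyset\neq Z\subsetneq W}\mathcal{D}_g(Z,W\setminus Z)$ if $|W|\geq2$. A dependence epistemic model is $\mathcal{M}=\langle S,T,V,U,\sim_i,\approx\rangle$: $S$ a set of worlds, $T:S\times\mathbb{P}\to\{0,1\}$, $V\supseteq\mathbb{V}$ a countable set of variables, $U:S\times V\to\mathbb{N}$, $\sim_i,\approx$ equivalence relations on $S$. For $X\subseteq V$, $X_s=X_t$ iff $U(s,x)=U(t,x)$ for all $x\in X$, else $X_s\neq X_t$. Semantics: $\top$ always true; $s\vDash p$ iff $T(s,p)=1$; Boolean clauses as usual; $s\vDash\mathcal{K}\phi$ iff $t\vDash\phi$ for all $t\sim_i s$; $s\vDash\mathcal{A}\phi$ iff $t\vDash\phi$ for all $t\approx s$; $s\vDash\mathcal{D}_g(X,Y)$ iff there exist $u,v\in S$ with $u\approx v\approx s$, $(V\setminus(X\cup Y))_u=(V\setminus(X\cup Y))_v$, $X_u\neq X_v$ and $Y_u\neq Y_v$. 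*)

(* Defs.v *)
From mathcomp Require Import all_boot.
From mathcomp Require Import finmap.
From mathcomp Require Import classical_sets.
From Stdlib Require Import RelationClasses.
From Stdlib Require List.

Set Implicit Arguments.
Unset Strict Implicit.
Unset Printing Implicit Defensive.

Inductive form (P V : countType) : Type :=
| Top : form P V
| Atom : P -> form P V
| Neg : form P V -> form P V
| And : form P V -> form P V -> form P V
| Know : form P V -> form P V
| All : form P V -> form P V
| Dg : {fset V} -> {fset V} -> form P V.

Arguments Top {P V}.
Arguments And {P V} _ _.
Arguments Atom {P V} _.
Arguments Dg {P V} _ _.

Section Connectives.
Context {P V : countType}.
Implicit Types a b : form P V.

Definition Bot : form P V := Neg Top.
Definition Or a b := Neg (And (Neg a) (Neg b)).
Definition Imp a b := Neg (And a (Neg b)).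
Definition Iff a b := And (Imp a b) (Imp b a).

(* Only meaningful for nonempty W. *)
Definition Q (W : {fset V}) : form P V :=
  if #|` W| == 1 then Dg W W
  else \big[And/Top]_(Z <- fpowerset W | (Z != fset0) && (Z `<` W)%fset)
         Dg Z (W `\` Z)%fset.

(* The disjunction over pairs (X', Y') of nonempty subsets X' of X, Y' of Y. *)
Definition Qdisj (X Y : {fset V}) : form P V :=
  \big[Or/Bot]_(p <- (fpowerset X `*` fpowerset Y)%fset
                | (p.1 != fset0) && (p.2 != fset0))
    Q (p.1 `|` p.2)%fset.

End Connectives.

(* Propositional formulas, to express instances of tautologies by substitution. *)
Inductive pform : Type :=
| PVar : nat -> pform
| PTop : pform
| PNeg : pform -> pform
| PAnd : pform -> pform -> pform.

Fixpoint peval (v : nat -> bool) (f : pform) : bool :=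
  match f with
  | PVar n => v n
  | PTop => true
  | PNeg g => ~~ peval v g
  | PAnd g h => peval v g && peval v h
  end.

Definition tautology (f : pform) : Prop := forall v, peval v f.

Fixpoint psubst (P V : countType) (sigma : nat -> form P V) (f : pform)
    : form P V :=
  match f with
  | PVar n => sigma n
  | PTop => Top
  | PNeg g => Neg (psubst sigma g)
  | PAnd g h => And (psubst sigma g) (psubst sigma h)
  end.

Inductive modality : Type := ModK | ModA.

Definition Box (P V : countType) (m : modality) : form P V -> form P V :=
  match m with ModK => @Know P V | ModA => @All P V end.

Inductive provable (P V : countType) : form P V -> Prop :=
| ax_taut f (sigma : nat -> form P V) :
    tautology f -> provable (psubst sigma f)
| rule_mp a b : provable (Imp a b) -> provable a -> provable b
| rule_nec m a : provable a -> provable (Box m a)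
| ax_K m a b : provable (Imp (Box m (Imp a b)) (Imp (Box m a) (Box m b)))
| ax_T m a : provable (Imp (Box m a) a)
| ax_4 m a : provable (Imp (Box m a) (Box m (Box m a)))
| ax_5 m a : provable (Imp (Neg (Box m a)) (Box m (Neg (Box m a))))
| ax_Q (X Y : {fset V}) : X != fset0 -> Y != fset0 ->
    provable (Iff (Dg X Y) (Qdisj X Y))
| ax_E_sym (X : {fset V}) : provable (Iff (Dg fset0 X) (Dg X fset0))
| ax_E_bot (X : {fset V}) : provable (Iff (Dg X fset0) Bot)
| ax_4_Dg (X Y : {fset V}) : provable (Imp (Dg X Y) (All (Dg X Y))).

(* Necessitation applies to theorems only: premises enter a derivation through
   a finite conjunction. *)
Definition derives (P V : countType) (Gamma : form P V -> Prop) (a : form P V)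
    : Prop :=
  exists2 gs : seq (form P V),
    List.Forall Gamma gs & provable (Imp (\big[And/Top]_(g <- gs) g) a).

(* The inclusion of the object-language variables V in the model's variables
   [mvar] is an injection [mincl]. *)
Record model (P V : countType) : Type := Model {
  world : Type;
  mval : world -> P -> bool;
  mvar : countType;
  mincl : V -> mvar;
  mincl_inj : injective mincl;
  mdata : world -> mvar -> nat;
  msim : world -> world -> Prop;
  msim_equiv : Equivalence msim;
  mapprox : world -> world -> Prop;
  mapprox_equiv : Equivalence mapprox
}.

Definition agree (P V : countType) (M : model P V) (X : set (mvar M))
    (s t : world M) : Prop :=
  forall x, X x -> mdata s x = mdata t x.

Definition mset (P V : countType) (M : model P V) (X : {fset V})
    : set (mvar M) := image [set` X]%classic (@mincl P V M).

Arguments mset {P V} M X.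

Fixpoint sat (P V : countType) (M : model P V) (s : world M) (a : form P V)
    : Prop :=
  match a with
  | Top => True
  | Atom p => mval s p
  | Neg b => ~ sat s b
  | And b c => sat s b /\ sat s c
  | Know b => forall t, msim t s -> sat t b
  | All b => forall t, mapprox t s -> sat t b
  | Dg X Y => exists u v,
      [/\ mapprox u v, mapprox v s,
          agree (~` (mset M X `|` mset M Y))%classic u v,
          ~ agree (mset M X) u v & ~ agree (mset M Y) u v]
  end.

Definition entails (P V : countType) (Gamma : form P V -> Prop) (a : form P V)
    : Prop :=
  forall (M : model P V) (s : world M),
    (forall g, Gamma g -> sat s g) -> sat s a.

(* Main.v *)
(** Completeness uses a canonical model built from maximal consistent sets in
    which every world [s] is duplicated into copies [(s, W, b)], one pair for
    each finite set [W] of variables.  The two copies indexed by [W] differ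
    exactly on [W] when [s] contains [Q(W)] and agree otherwise, while one
    additional variable records [W] and so separates copies with distinct
    indices.  The finite difference sets avoiding the additional variable are
    thus the sets [W] with [Q(W)] in [s], and axiom Q says that these are
    exactly the witnesses required by the formulas [Dg X Y] in [s]. *)

Require Import Defs.
From HB Require Import structures.
From mathcomp Require Import all_boot.
From mathcomp Require Import finmap boolp classical_sets.
From Stdlib Require Import RelationClasses.

Set Implicit Arguments.
Unset Strict Implicit.
Unset Printing Implicit Defensive.

(** Classical equality on formulas suffices for [index] and [\in] on lists of formulas. *)
HB.instance Definition _ (P V : countType) := gen_eqMixin (form P V).

(** * Sets of formulas obeying the Boolean clauses *)

Section Propositional.
Context {P V : countType}.
Implicit Types (a b c : form P V) (gs hs : seq (form P V)) (X Y W Z : {fset V}).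

(** Common abstraction of the set of formulas true at a world and of a maximal consistent set, so
    that the unfoldings of [Q] and [Qdisj] serve both soundness and completeness. *)
Record propositional (S : form P V -> Prop) : Prop := Propositional {
  propT : S Top;
  propN : forall a, S (Neg a) <-> ~ S a;
  propA : forall a b, S (And a b) <-> S a /\ S b
}.

Section Connectives.
Variable S : form P V -> Prop.
Hypothesis SP : propositional S.

Lemma propBot : ~ S Bot.
Proof. by move/(propN SP); apply; exact: (propT SP). Qed.

Lemma propOr a b : S (Or a b) <-> S a \/ S b.
Proof.
rewrite /Or (propN SP) (propA SP) !(propN SP).
by have [] := pselect (S a); have [] := pselect (S b); tauto.
Qed.

Lemma propImp a b : S (Imp a b) <-> (S a -> S b).
Proof.
rewrite /Imp (propN SP) (propA SP) (propN SP).
by have [] := pselect (S a); have [] := pselect (S b); tauto.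
Qed.

Lemma propIff a b : S (Iff a b) <-> (S a <-> S b).
Proof. by rewrite /Iff (propA SP) !propImp. Qed.

Lemma prop_bigAnd (I : eqType) (r : seq I) (p : pred I) (F : I -> form P V) :
  S (\big[And/Top]_(i <- r | p i) F i) <->
  forall i, i \in r -> p i -> S (F i).
Proof.
elim: r => [|j r IH]; first by rewrite big_nil; split=> // _; exact: propT SP.
have consE : (forall i, i \in j :: r -> p i -> S (F i)) <->
    (p j -> S (F j)) /\ (forall i, i \in r -> p i -> S (F i)).
  split=> [h|[hj hr] i].
    by split=> [|i ir]; apply: h; rewrite inE ?eqxx ?ir ?orbT.
  by rewrite inE => /orP[/eqP->|/hr].
rewrite big_cons consE; case: (p j); rewrite ?(propA SP) IH; last by intuition.
by intuition.
Qed.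

Lemma prop_bigOr (I : eqType) (r : seq I) (p : pred I) (F : I -> form P V) :
  S (\big[Or/Bot]_(i <- r | p i) F i) <->
  exists i, [/\ i \in r, p i & S (F i)].
Proof.
elim: r => [|j r IH].
  by rewrite big_nil; split=> [/propBot|[i []]].
have consE : (exists i, [/\ i \in j :: r, p i & S (F i)]) <->
    (p j /\ S (F j)) \/ exists i, [/\ i \in r, p i & S (F i)].
  split=> [[i []]|[[pj Sj]|[i [ir pi Si]]]].
  - by rewrite inE => /orP[/eqP->|ir] pi Si; [left|right; exists i].
  - by exists j; rewrite inE eqxx.
  - by exists i; rewrite inE ir orbT.
rewrite big_cons consE; case: (p j); rewrite ?propOr IH; last by intuition.
by intuition.
Qed.

Lemma prop_Q W :
  S (Q W) <-> if #|` W| == 1 then S (Dg W W)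
              else forall Z, Z != fset0 -> (Z `<` W)%fset ->
                S (Dg Z (W `\` Z)%fset).
Proof.
rewrite /Q; case: ifP => // _; rewrite prop_bigAnd; split=> [h Z Z0 ZW|h Z _].
  by apply: h; rewrite ?Z0 // fpowersetE fproper_sub.
by move=> /andP[]; exact: h.
Qed.

Lemma prop_Qdisj X Y :
  S (Qdisj X Y) <-> exists X' Y', [/\ (X' `<=` X)%fset, (Y' `<=` Y)%fset,
    X' != fset0, Y' != fset0 & S (Q (X' `|` Y')%fset)].
Proof.
rewrite /Qdisj prop_bigOr; split=> [[[X' Y'] []]|[X' [Y' [XX YY X0 Y0 SQ]]]].
  rewrite in_fsetM /= !fpowersetE => /andP[XX YY] /andP[X0 Y0] SQ.
  by exists X', Y'.
by exists (X', Y'); rewrite in_fsetM /= !fpowersetE XX YY X0 Y0.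
Qed.

Lemma prop_psubst sigma f :
  S (psubst sigma f) <-> peval (fun n => `[< S (sigma n) >]) f.
Proof.
elim: f => [n||g IH|g IHg h IHh] /=.
- exact: (rwP (asboolP _)).
- by split=> // _; exact: propT SP.
- by rewrite (propN SP) IH; split => /negP.
- by rewrite (propA SP) IHg IHh; split => [[-> ->]|/andP].
Qed.

End Connectives.

(** * Provability of tautologies by Boolean evaluation *)

(** Atoms and formulas headed by [Know], [All] or [Dg] are opaque here: they act as the
    propositional variables of a formula. *)
Fixpoint beval (v : form P V -> bool) a : bool :=
  match a with
  | Top => true
  | Neg b => ~~ beval v b
  | And b c => beval v b && beval v c
  | _ => v a
  end.

Fixpoint modal_atoms a : seq (form P V) :=
  match a with
  | Top => [::]
  | Neg b => modal_atoms b
  | And b c => modal_atoms b ++ modal_atoms c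
  | _ => [:: a]
  end.

Fixpoint skeleton (l : seq (form P V)) a : pform :=
  match a with
  | Top => PTop
  | Neg b => PNeg (skeleton l b)
  | And b c => PAnd (skeleton l b) (skeleton l c)
  | _ => PVar (index a l)
  end.

Lemma psubst_skeleton l a :
  {subset modal_atoms a <= l} -> psubst (nth Top l) (skeleton l a) = a.
Proof.
elim: a => //=.
- by move=> p al; rewrite nth_index ?al ?mem_head.
- by move=> b IH al; rewrite IH.
- by move=> b IHb c IHc al; rewrite IHb ?IHc // => x xb; apply: al;
    rewrite mem_cat xb ?orbT.
- by move=> b _ al; rewrite nth_index ?al ?mem_head.
- by move=> b _ al; rewrite nth_index ?al ?mem_head.
- by move=> X Y al; rewrite nth_index ?al ?mem_head.
Qed.

Lemma peval_skeleton l v a :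
  peval v (skeleton l a) = beval (fun b => v (index b l)) a.
Proof. by elim: a => //= [b ->|b -> c ->]. Qed.

(** Naming each opaque subformula by its position in [modal_atoms a] turns [a] into a [pform] that
    has [a] as a substitution instance. Every valuation of these names is induced by a valuation of
    the opaque formulas, so the [pform] is a tautology. *)
Lemma provable_taut a : (forall v, beval v a) -> provable a.
Proof.
move=> h; rewrite -(@psubst_skeleton (modal_atoms a) a) //.
by apply: ax_taut => v; rewrite peval_skeleton.
Qed.

Lemma beval_conj v gs : beval v (\big[And/Top]_(g <- gs) g) = all (beval v) gs.
Proof. by elim: gs => [|g gs IH]; rewrite ?big_nil // big_cons /= IH. Qed.

Lemma beval_Imp v a b : beval v (Imp a b) = (beval v a ==> beval v b).
Proof. by rewrite /= negb_and negbK implybE. Qed.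

Lemma provable_taut_mp a b :
  provable a -> (forall v, beval v a -> beval v b) -> provable b.
Proof.
move=> pa ab; apply: rule_mp pa; apply: provable_taut => v.
by rewrite beval_Imp; apply/implyP/ab.
Qed.

(** * Derivability from premises *)

Lemma Forall_mem (G : form P V -> Prop) gs :
  List.Forall G gs <-> forall g, g \in gs -> G g.
Proof.
elim: gs => [|g gs IH]; first by split=> // _; constructor.
split=> [H x|H].
  inversion H as [|? ? Gg Ggs]; subst.
  by rewrite inE => /orP[/eqP->//|]; exact: (IH.1 Ggs).
by constructor; [apply: H; rewrite mem_head|
  apply/IH => x xg; apply: H; rewrite inE xg orbT].
Qed.

Implicit Types G H : form P V -> Prop.

Lemma derivesP G a :
  derives G a <-> exists2 gs, (forall g, g \in gs -> G g)
                            & provable (Imp (\big[And/Top]_(g <- gs) g) a).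
Proof. by split=> -[gs /Forall_mem ? ?]; exists gs => //; apply/Forall_mem. Qed.

Lemma derives_provable G a : provable a -> derives G a.
Proof.
move=> pa; exists [::] => //; apply: provable_taut_mp pa _ => v.
by rewrite beval_Imp => ->; rewrite implybT.
Qed.

Lemma derives_mem G a : G a -> derives G a.
Proof.
move=> Ga; exists [:: a]; first by constructor.
by apply: provable_taut => v; rewrite beval_Imp beval_conj /= andbT implybb.
Qed.

Lemma derives_mp G a b : derives G (Imp a b) -> derives G a -> derives G b.
Proof.
move=> /derivesP[gs Ggs p1] /derivesP[hs Ghs p2]; apply/derivesP.
exists (gs ++ hs) => [g|]; first by rewrite mem_cat => /orP[/Ggs|/Ghs].
have : provable (Imp (\big[And/Top]_(g <- hs) g)
                     (Imp (\big[And/Top]_(g <- gs) g) b)).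
  apply: rule_mp p2; apply: provable_taut_mp p1 _ => v.
  rewrite !beval_Imp.
  by do 4!case: (beval v _).
move/provable_taut_mp; apply=> v; rewrite !beval_Imp !beval_conj all_cat.
by do 2!case: (all _ _); case: (beval _ _).
Qed.

Lemma derives_taut G a b : (forall v, beval v a -> beval v b) ->
  derives G a -> derives G b.
Proof.
move=> ab; apply: derives_mp; apply/derives_provable/provable_taut => v.
by rewrite beval_Imp; apply/implyP/ab.
Qed.

(** Deleting [a] from the list of premises leaves premises from [G] only, and the deleted
    occurrences are restored by the antecedent [a]. *)
Lemma deduction G a b :
  derives (fun c => G c \/ c = a) b -> derives G (Imp a b).
Proof.
move=> /derivesP[gs Ggs pb]; apply/derivesP.
exists [seq g <- gs | g != a] => [g|].
  by rewrite mem_filter => /andP[/eqP ga /Ggs[]].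
apply: provable_taut_mp pb _ => v; rewrite !beval_Imp !beval_conj all_filter.
case va: (beval v a); rewrite ?implybT //= => /implyP h; apply/implyP => ag.
apply: h; apply/allP => g gg; have /allP/(_ g gg)/= := ag.
by case: eqP => [->|].
Qed.

(** * Consistency, Lindenbaum's lemma and maximal consistent sets *)

Definition consistent G := ~ derives G Bot.

Definition mcs G := consistent G /\ forall a, G a \/ G (Neg a).

Lemma consistent_extend G a : ~ derives G a ->
  consistent (fun c => G c \/ c = Neg a).
Proof.
move=> nGa /deduction h; apply: nGa; apply: derives_taut h => v.
by rewrite beval_Imp /=; case: (beval _ _).
Qed.

(** Zorn's lemma applies because a derivation of [Bot] uses finitely many premises, and those drawn
    from the union of a chain already lie in a single member of it. *)
Lemma lindenbaum G : consistent G ->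
  exists2 S, mcs S & forall g, G g -> S g.
Proof.
(* Consistency is asked of the union with [G], so the empty chain is covered by the consistency of
   [G] itself; it gives the first alternative of the [suff] below. *)
move=> Gc; pose ok (A : set (form P V)) := consistent (fun c => G c \/ A c).
have [|A [Aok Amax]] := @Zorn_bigcup _ ok.
  move=> F Fok Ftot /derivesP[gs Ggs p].
  suff [Ggs'|[A FA GAgs]] : (forall g, g \in gs -> G g) \/
      exists2 A, F A & forall g, g \in gs -> G g \/ A g.
  - by apply: Gc; apply/derivesP; exists gs.
  - by apply: (Fok A FA); apply/derivesP; exists gs.
  elim: gs Ggs {p} => [|g gs IH] Ggs; first by left.
  have {IH} := IH (fun x xg => Ggs x (mem_behead (s := g :: gs) xg)).
  have [Gg|[A FA Ag]] := Ggs g (mem_head _ _).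
    case=> [Ggs'|[A FA GAgs]]; [left|right; exists A => //];
      by move=> x; rewrite inE => /orP[/eqP->|]; auto.
  case=> [Ggs'|[B FB GBgs]]; right.
    by exists A => // x; rewrite inE => /orP[/eqP->|]; auto.
  have [AB|BA] := Ftot _ _ FA FB; [exists B|exists A] => // x;
    rewrite inE => /orP[/eqP->|/GBgs[]]; auto.
exists (fun c => G c \/ A c) => [|g]; last by left.
(* By maximality, a formula outside the extension is inconsistent with it, so its negation is
   derivable. If both [a] and [Neg a] were outside, the extension would derive [Bot]. *)
have step a : ~ (G a \/ A a) -> derives (fun c => G c \/ A c) (Neg a).
  move=> na; have : ~ ok (fun c => A c \/ c = a).
    apply: Amax; split=> [c|]; first by left.
    by move=> /(_ a (or_intror erefl)); auto.
  move=> /contrapT h.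
  have {}h : derives (fun c => (G c \/ A c) \/ c = a) Bot.
    have -> // : (fun c => (G c \/ A c) \/ c = a) =
        (fun c => G c \/ A c \/ c = a).
    by apply/funext => c; apply/propext; tauto.
  apply: derives_taut (deduction h) => v.
  by rewrite beval_Imp /=; case: (beval _ _).
split=> // a; have [|/step na] := pselect (G a \/ A a); first by left.
have [|/step nna] := pselect (G (Neg a) \/ A (Neg a)); first by right.
case: Aok; apply: derives_mp na; apply: derives_taut nna => v.
by rewrite beval_Imp /= => /negPf ->.
Qed.

Section MaximalConsistent.
Variable S : form P V -> Prop.
Hypothesis SM : mcs S.

Lemma mcs_derives a : derives S a -> S a.
Proof.
move=> Da; have [//|/derives_mem Dna] := SM.2 a; case: SM.1.
apply: derives_mp Da; apply: derives_taut Dna => v.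
by rewrite beval_Imp /= => /negPf ->.
Qed.

Lemma mcs_propositional : propositional S.
Proof.
split=> [|a|a b].
- by apply/mcs_derives/derives_provable/provable_taut.
- split=> [/derives_mem Dna /derives_mem Da|]; last by have [] := SM.2 a.
  case: SM.1; apply: derives_mp Da; apply: derives_taut Dna => v.
  by rewrite beval_Imp /= => /negPf ->.
- split=> [/derives_mem Dab|[/derives_mem Da /derives_mem Db]].
    by split; apply: mcs_derives; apply: derives_taut Dab => v /= /andP[].
  apply: mcs_derives; apply: derives_mp Db; apply: derives_taut Da => v.
  by rewrite beval_Imp /= => ->; rewrite implybb.
Qed.

Lemma mcs_provable a : provable a -> S a.
Proof. by move=> /derives_provable/mcs_derives. Qed.

Lemma mcs_mp a b : provable (Imp a b) -> S a -> S b.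
Proof. by move=> /mcs_provable/(propImp mcs_propositional). Qed.

(** Induction on the list of premises moves them one at a time into the conclusion; necessitation
    handles the empty list, and [ax_K] detaches each boxed premise. *)
Lemma mcs_Box_derives m G a : (forall g, G g -> S (Box m g)) ->
  derives G a -> S (Box m a).
Proof.
move=> GS /derivesP[gs Ggs]; elim: gs a Ggs => [|g gs IH] a Ggs pa.
  apply: mcs_provable; apply: rule_nec; apply: provable_taut_mp pa _ => v.
  by rewrite big_nil beval_Imp.
have Sg : S (Box m g) by apply: GS; apply: Ggs; rewrite mem_head.
suff : S (Box m (Imp g a)).
  by move=> /(mcs_mp (ax_K _ _ _))/(propImp mcs_propositional); apply.
apply: IH => [x xg|]; first by apply: Ggs; rewrite inE xg orbT.
apply: provable_taut_mp pa _ => v; rewrite big_cons !beval_Imp /=.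
by do 3!case: (beval v _).
Qed.

End MaximalConsistent.

(** * Canonical accessibility relations *)

(** For maximal consistent sets this is the usual canonical relation of S5, in a form that is
    visibly an equivalence. *)
Definition canonical_rel m G H := forall a, G (Box m a) <-> H (Box m a).

(** The existence lemma. Let [G] collect the formulas [Box m b] and [Neg (Box m b)] in [S]. By
    axioms 4 and 5 the box of each of them is in [S], so deriving [a] from [G] would put [Box m a]
    in [S]. Otherwise a maximal consistent extension of [G] with [Neg a] agrees with [S] on boxed
    formulas and refutes [a]. *)
Lemma canonical_Box S m a : mcs S ->
  (S (Box m a) <-> forall T, mcs T -> canonical_rel m T S -> T a).
Proof.
move=> SM; split=> [Sa T TM TS|h].
  by apply: (mcs_mp TM (ax_T _ _)); apply/TS.
apply: contrapT => nSa.
pose G c := S c /\ exists b, c = Box m b \/ c = Neg (Box m b).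
have nGa : ~ derives G a.
  apply: contra_not nSa; apply: mcs_Box_derives => // g [Sg [b [gE|gE]]].
    by move: Sg; rewrite gE => /(mcs_mp SM (ax_4 _ _)).
  by move: Sg; rewrite gE => /(mcs_mp SM (ax_5 _ _)).
have [T TM GT] := lindenbaum (consistent_extend nGa).
have Tna : T (Neg a) by apply: GT; right.
case/(propN (mcs_propositional TM)): Tna; apply: h => // b.
split=> [Tb|Sb]; last by apply: GT; left; split=> //; exists b; left.
have [//|Snb] := SM.2 (Box m b).
suff : T (Neg (Box m b)) by move/(propN (mcs_propositional TM)).
by apply: GT; left; split=> //; exists b; right.
Qed.

End Propositional.

(** * Combinatorics of finite difference sets *)

Section Crossing.
Context {V : countType}.
Implicit Types (X Y D W Z : {fset V}) (H : {fset V} -> Prop).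

(** The condition under which two worlds differing exactly on [D] witness [Dg X Y]. *)
Definition crosses X Y D :=
  [/\ (D `<=` X `|` Y)%fset, (D `&` X)%fset != fset0 & (D `&` Y)%fset != fset0].

Lemma crosses_self X : X != fset0 -> crosses X X X.
Proof. by move=> X0; split; rewrite ?fsetIid ?fsetUid. Qed.

(** Together with [crosses_self], this makes a nonempty difference set [W] witness every conjunct of
    [Q W]. *)
Lemma crosses_proper Z W : Z != fset0 -> (Z `<` W)%fset ->
  crosses Z (W `\` Z)%fset W.
Proof.
move=> Z0 ZW; have ZsW := fproper_sub ZW; split.
- by rewrite fsetUDl fsetDv fsetD0 fsubsetUr.
- by rewrite (fsetIidPr ZsW).
- rewrite (fsetIidPr (fsubsetDl _ _)) fsetD_eq0.
  by move: ZW; rewrite fproperEneq => /andP[]; rewrite eqEfsubset ZsW.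
Qed.

(** Both [X'] and [Y'] equal the singleton [W], so its element lies in [X] and in [Y]; it also lies
    in [D], which meets [W]. *)
Lemma crosses_singleton X Y X' Y' D (W := (X' `|` Y')%fset) :
  (X' `<=` X)%fset -> (Y' `<=` Y)%fset -> X' != fset0 -> Y' != fset0 ->
  #|` W| == 1 -> crosses W W D -> crosses X Y D.
Proof.
move=> XX YY X0 Y0 /cardfs1P[w Ww] [].
rewrite fsetUid Ww => Dw /fset0Pn[z] /[!in_fsetI] /andP[zD zw] _.
have [x xX'] := fset0Pn _ X0; have [y yY'] := fset0Pn _ Y0.
have memW t : t \in W -> t = w by rewrite Ww in_fset1 => /eqP.
have xw : x = w by apply: memW; rewrite in_fsetU xX'.
have yw : y = w by apply: memW; rewrite in_fsetU yY' orbT.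
have {zw}zw : z = w by apply/eqP; rewrite -in_fset1.
split; first by apply: fsubset_trans Dw _; rewrite -Ww; exact: fsetUSS.
  by apply/fset0Pn; exists w; rewrite in_fsetI -{1}zw zD -xw (fsubsetP XX).
by apply/fset0Pn; exists w; rewrite in_fsetI -{1}zw zD -yw (fsubsetP YY).
Qed.

(* The difference sets contained in W make W a connected hypergraph; such a
   connected hypergraph has an edge crossing from X to Y. *)
Lemma crosses_connected H X Y X' Y' (W := (X' `|` Y')%fset) :
  (X' `<=` X)%fset -> (Y' `<=` Y)%fset -> X' != fset0 -> Y' != fset0 ->
  #|` W| != 1 ->
  (forall Z, Z != fset0 -> (Z `<` W)%fset ->
     exists2 D, H D & crosses Z (W `\` Z)%fset D) ->
  exists2 D, H D & crosses X Y D.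
Proof.
move=> XX YY X0 Y0 W1 conn.
have WXY : (W `<=` X `|` Y)%fset by apply: fsetUSS.
have [x xX'] := fset0Pn _ X0; have [y yY'] := fset0Pn _ Y0.
have xW : x \in W by rewrite in_fsetU xX'.
have yW : y \in W by rewrite in_fsetU yY' orbT.
have sub Z D : (Z `<=` W)%fset -> crosses Z (W `\` Z)%fset D ->
    (D `<=` W)%fset.
  by move=> ZW [DZ _ _]; rewrite fsetUDl fsetDv fsetD0 (fsetUidPr _ _ ZW) in DZ.
(* If [W] lies inside [X], cutting along [X] gives no proper part. Splitting off one [y] of [Y']
   instead yields a [D] containing [y], which belongs to both [X] and [Y]. *)
have [WX|nWX] := boolP (W `<=` X)%fset.
  have ZW : ([fset y] `<` W)%fset.
    rewrite fproperEneq fsub1set yW andbT; apply: contra W1 => /eqP <-.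
    by rewrite cardfs1.
  have [|D HD Dc] := conn [fset y]%fset _ ZW.
    by apply/fset0Pn; exists y; rewrite in_fset1.
  have DW := sub _ _ (fproper_sub ZW) Dc; case: Dc => _ /fset0Pn[z].
  rewrite in_fsetI in_fset1 => /andP[yD /eqP zy]; rewrite zy in yD => _.
  exists D => //; split; first exact: fsubset_trans DW WXY.
    by apply/fset0Pn; exists y; rewrite in_fsetI yD (fsubsetP WX).
  by apply/fset0Pn; exists y; rewrite in_fsetI yD (fsubsetP YY).
(* Otherwise cut [W] along [X]: the crossing set has a point in [X] and a point of [W] outside [X],
   which must be in [Y]. *)
have ZW : ((W `&` X)%fset `<` W)%fset.
  rewrite fproperEneq fsubsetIl andbT; apply: contra nWX => /eqP <-.
  exact: fsubsetIr.
have [|D HD Dc] := conn (W `&` X)%fset _ ZW.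
  by apply/fset0Pn; exists x; rewrite in_fsetI xW (fsubsetP XX).
have DW := sub _ _ (fproper_sub ZW) Dc.
case: Dc => _ /fset0Pn[z zD] /fset0Pn[t].
move: zD; rewrite !in_fsetI => /and3P[zD _ zX].
rewrite in_fsetD in_fsetI => /and3P[tD tX tW].
exists D => //; split; first exact: fsubset_trans DW WXY.
  by apply/fset0Pn; exists z; rewrite in_fsetI zD.
apply/fset0Pn; exists t; rewrite in_fsetI tD /=.
by move: tX (fsubsetP WXY _ tW); rewrite tW /= in_fsetU => /negPf ->.
Qed.

End Crossing.

(** * Soundness *)

Section Soundness.
Context {P V : countType}.
Implicit Types (M : model P V) (a b : form P V) (X Y D W : {fset V}).

(** Here [z] ranges over all variables of the model, so the two worlds also agree on every variable
    outside the language. *)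
Definition difference_set M (s : world M) D := exists u v : world M,
  [/\ mapprox u v, mapprox v s
    & forall z, mdata u z <> mdata v z <-> mset M D z].

Lemma mset_mincl M X x : mset M X (mincl M x) <-> x \in X.
Proof.
by split=> [[y /= yX /mincl_inj <-]|xX] //; exists x.
Qed.

(** Two worlds agreeing off [X] and [Y] differ only on language variables from a finite set, so
    their exact difference is a finite set [D]. The semantic clause thereby becomes a statement
    about crossing sets. *)
Lemma sat_Dg M (s : world M) X Y :
  sat s (Dg X Y) <-> exists2 D, difference_set s D & crosses X Y D.
Proof.
have disagree u v Z : ~ agree (mset M Z) u v <->
    exists2 x, x \in Z & mdata u (mincl M x) <> mdata v (mincl M x).
  split=> [nag|[x xZ ne] ag]; last by apply: ne; apply: ag; apply/mset_mincl.
  apply: contrapT => nex; apply: nag => _ [x /= xZ <-].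
  by apply: contrapT => ne; apply: nex; exists x.
split=> /= [[u [v [uv vs ag /disagree[x xX dx] /disagree[y yY dy]]]]|].
  pose D := [fset x in (X `|` Y)%fset |
               mdata u (mincl M x) != mdata v (mincl M x)]%fset.
  have inD z : z \in D =
      (z \in (X `|` Y)%fset) && (mdata u (mincl M z) != mdata v (mincl M z)).
    by rewrite !inE.
  exists D.
    exists u, v; split=> // z; split=> [dz|[t /= tD <-]]; last first.
      by move: tD; rewrite inD => /andP[_ /eqP].
    have [[/=|] [t /= tX tz]|nz] := pselect ((mset M X `|` mset M Y)%classic z).
    - exists t => //=; rewrite inD in_fsetU tX /= tz; exact/eqP.
    - exists t => //=; rewrite inD in_fsetU tX orbT /= tz; exact/eqP.
    - by case: dz; apply: ag.
  split; first by apply/fsubsetP => z; rewrite inD => /andP[].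
    by apply/fset0Pn; exists x; rewrite in_fsetI inD in_fsetU xX; apply/andP;
      split=> //; apply/eqP.
  by apply/fset0Pn; exists y; rewrite in_fsetI inD in_fsetU yY orbT; apply/andP;
    split=> //; apply/eqP.
move=> [D [u [v [uv vs dif]]] [DXY /fset0Pn[x] + /fset0Pn[y]]].
rewrite !in_fsetI => /andP[xD xX] /andP[yD yY].
exists u, v; split=> //.
- move=> z nz; apply: contrapT => /dif[t /= tD tz]; apply: nz; rewrite -tz.
  by move/(fsubsetP DXY): tD; rewrite in_fsetU => /orP[] tX; [left|right];
    exists t.
- by apply/disagree; exists x => //; apply/dif/mset_mincl.
- by apply/disagree; exists y => //; apply/dif/mset_mincl.
Qed.

Lemma sat_propositional M (s : world M) : propositional (sat s).
Proof. by []. Qed.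

Definition msim_of M (m : modality) : world M -> world M -> Prop :=
  match m with ModK => @msim _ _ M | ModA => @mapprox _ _ M end.

Lemma msim_of_equiv M m : Equivalence (@msim_of M m).
Proof. by case: m; [exact: msim_equiv | exact: mapprox_equiv]. Qed.

Lemma sat_Box M m (s : world M) a :
  sat s (Box m a) <-> forall t, msim_of m t s -> sat t a.
Proof. by case: m. Qed.

Lemma sat_Imp M (s : world M) a b : (sat s a -> sat s b) -> sat s (Imp a b).
Proof. by move/(propImp (sat_propositional s)). Qed.

Lemma soundness a : provable a -> forall M (s : world M), sat s a.
Proof.
elim=> {a}.
- move=> f sigma taut M s; apply/(prop_psubst (sat_propositional s)).
  exact: taut.
- move=> a b _ IHab _ IHa M s.
  by move/(propImp (sat_propositional s)): (IHab M s); apply.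
- by move=> m a _ IH M s; apply/sat_Box => t _.
- move=> m a b M s; apply: sat_Imp => /sat_Box ab.
  apply: sat_Imp => /sat_Box ha.
  apply/sat_Box => t ts; move/(propImp (sat_propositional t)): (ab t ts).
  by apply; exact: ha.
- move=> m a M s; apply: sat_Imp => /sat_Box; apply.
  by have [r _ _] := msim_of_equiv M m.
- move=> m a M s; apply: sat_Imp => /sat_Box ha.
  have [_ _ tr] := msim_of_equiv M m.
  by apply/sat_Box => t ts; apply/sat_Box => w wt; apply: ha; apply: tr ts.
- move=> m a M s; apply: sat_Imp => na; have [_ sy tr] := msim_of_equiv M m.
  apply/sat_Box => t ts; apply: contra_not na => /sat_Box ha.
  by apply/sat_Box => w ws; apply: ha; apply: tr ws (sy _ _ ts).
- move=> X Y X0 Y0 M s; have SP := sat_propositional s.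
  apply/(propIff SP); rewrite sat_Dg (prop_Qdisj SP).
  (* From left to right, the parts of [D] in [X] and in [Y] serve as [X'] and [Y']: their union is
     [D], which witnesses all of [Q D]. *)
  split=> [[D Dd [DXY DX DY]]|[X' [Y' [XX YY X'0 Y'0 /(prop_Q SP)]]]].
    exists (D `&` X)%fset, (D `&` Y)%fset; split; rewrite ?fsubsetIr //.
    rewrite -fsetIUr (fsetIidPl DXY); apply/(prop_Q SP).
    case: ifP => _ => [|Z Z0 ZD]; apply/sat_Dg; exists D => //.
      apply: crosses_self; apply: contraNneq DX => ->.
      by rewrite fset0I.
    exact: crosses_proper.
  (* Conversely, each conjunct of [Q] supplies a difference set; one of them crosses from [X] to
     [Y]. *)
  case: ifP => [W1 /sat_Dg[D Dd Dc]|/negbT W1 conn].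
    by exists D => //; exact: crosses_singleton Dc.
  apply: (crosses_connected XX YY X'0 Y'0 W1) => Z Z0 ZW.
  by apply/sat_Dg; exact: conn.
- move=> X M s; have SP := sat_propositional s; apply/(propIff SP).
  by rewrite !sat_Dg; split=> -[D _ []]; rewrite fsetI0 eqxx.
- move=> X M s; have SP := sat_propositional s; apply/(propIff SP).
  by rewrite sat_Dg; split=> [[D _ []]|/(propBot SP)//]; rewrite fsetI0 eqxx.
- move=> X Y M s; apply: sat_Imp => /= -[u [v [uv vs ag dX dY]]] t ts.
  have [_ sy tr] := mapprox_equiv M.
  by exists u, v; split=> //; apply: tr vs (sy _ _ ts).
Qed.

End Soundness.

(** * The canonical model and strong completeness *)

Section Completeness.
Context {P V : countType}.
Implicit Types (a : form P V) (X Y W : {fset V}).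

Definition mcs_world := {S : form P V -> Prop | mcs S}.

Definition copy : Type := mcs_world * {fset V} * bool.

Definition copy_rel m (s t : copy) :=
  canonical_rel m (sval s.1.1) (sval t.1.1).

Lemma copy_rel_equiv m : Equivalence (copy_rel m).
Proof.
split=> [s a|s t st a|s t w st tw a] //; first by rewrite (st a).
by rewrite (st a) (tw a).
Qed.

Definition copy_bit (s : copy) (x : V) : bool :=
  [&& s.2, x \in s.1.2 & `[< sval s.1.1 (Q s.1.2) >]].

(** [None] is the additional variable; [pickle] encodes the index injectively as a number. *)
Definition copy_data (s : copy) (x : option V) : nat :=
  if x is Some y then copy_bit s y
  else choice.pickle s.1.2.

Definition canonical_model : model P V :=
  @Model P V copy (fun s p => `[< sval s.1.1 (Atom p) >]) (option V) Some
    Some_inj copy_data (copy_rel ModK) (copy_rel_equiv ModK)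
    (copy_rel ModA) (copy_rel_equiv ModA).

(** [Q W] is built by conjunction from formulas [Dg X Y], and [ax_4_Dg] with axiom T for [All]
    carries each of these between related sets in both directions. *)
Lemma canonical_Q (S T : mcs_world) W :
  canonical_rel ModA (sval S) (sval T) -> sval S (Q W) <-> sval T (Q W).
Proof.
case: S T => S SM [T TM] /= ST.
have Dg_inv X Y : S (Dg X Y) <-> T (Dg X Y).
  split=> [/(mcs_mp SM (ax_4_Dg _ _ _))/ST|/(mcs_mp TM (ax_4_Dg _ _ _))/ST].
    exact: (mcs_mp TM (ax_T ModA _)).
  exact: (mcs_mp SM (ax_T ModA _)).
rewrite (prop_Q (mcs_propositional SM)) (prop_Q (mcs_propositional TM)).
by case: ifP => _ //; split=> h Z Z0 ZW; apply/Dg_inv; exact: h.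
Qed.

Lemma canonical_difference_set (s : world canonical_model) W : W != fset0 ->
  difference_set s W <-> sval s.1.1 (Q W).
Proof.
move=> W0; split=> [[u [v [uv vs dif]]]|SQ].
  have [x xW] := fset0Pn _ W0.
  (* The additional variable is outside [mset W], so [u] and [v] agree on it and have the same
     index. *)
  have uvW : u.1.2 = v.1.2.
    apply: contrapT => ne.
    have /dif[] // : mdata u None <> mdata v None.
    by move/(pcan_inj choice.pickleK).
  have mem y : (copy_bit u y != copy_bit v y) = (y \in W).
    apply/idP/idP => [/eqP ne|/(mset_mincl canonical_model)/dif/=].
      apply/(mset_mincl canonical_model)/dif => /=.
      by case: (copy_bit u y) ne; case: (copy_bit v y).
    by case: (copy_bit u y); case: (copy_bit v y).
  have bit_v y :
      copy_bit v y = [&& v.2, y \in u.1.2 & `[< sval u.1.1 (Q u.1.2) >]].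
    by rewrite /copy_bit -uvW -(asbool_equiv_eq (canonical_Q _ uv)).
  (* The bits differ at [x], which forces [Q] of the common index to hold and the two flags to be
     opposite; hence the bits differ on exactly that index. *)
  have Wu : W = u.1.2 /\ sval u.1.1 (Q u.1.2).
    have := mem x; rewrite xW.
    rewrite bit_v /copy_bit; case: asboolP => [Qu|_]; last by rewrite !andbF.
    rewrite !andbT => ux; split=> //; apply/fsetP => y; rewrite -mem.
    rewrite bit_v /copy_bit (asboolT Qu) !andbT.
    by move: ux; case: u.2; case: v.2; rewrite /= ?eqxx //; case: (y \in _).
  by rewrite Wu.1; apply/(canonical_Q _ vs)/(canonical_Q _ uv); exact: Wu.2.
exists (s.1.1, W, true), (s.1.1, W, false); split=> //= -[y|] /=.
  rewrite /copy_bit /= (asboolT SQ) andbT.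
  split=> [|[t /= tW [<-]]]; last by rewrite tW.
  by case yW: (y \in W) => // _; exists y.
by split=> // -[t].
Qed.

(** When [X] or [Y] is empty nothing crosses, matching axiom E; otherwise axiom Q reduces [Dg X Y]
    to the sets [W] with [Q W] in [s], which are the nonempty difference sets. *)
Lemma canonical_Dg (s : world canonical_model) X Y :
  sat s (Dg X Y) <-> sval s.1.1 (Dg X Y).
Proof.
rewrite sat_Dg; case: s => -[[S SM] i] b /=; have SP := mcs_propositional SM.
have [->|X0] := eqVneq X fset0.
  split=> [[D _ []]|]; first by rewrite fsetI0 eqxx.
  have /(propIff SP) -> := mcs_provable SM (ax_E_sym P Y).
  by have /(propIff SP) -> := mcs_provable SM (ax_E_bot P Y); move/(propBot SP).
have [->|Y0] := eqVneq Y fset0.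
  split=> [[D _ []]|]; first by rewrite fsetI0 eqxx.
  by have /(propIff SP) -> := mcs_provable SM (ax_E_bot P X); move/(propBot SP).
have /(propIff SP) -> := mcs_provable SM (ax_Q P X0 Y0).
rewrite (prop_Qdisj SP); split=> [[D DS [DXY DX DY]]|].
  exists (D `&` X)%fset, (D `&` Y)%fset; split; rewrite ?fsubsetIr //.
  rewrite -fsetIUr (fsetIidPl DXY).
  have D0 : D != fset0 by apply: contraNneq DX => ->; rewrite fset0I.
  by move/(canonical_difference_set _ D0): DS.
move=> [X' [Y' [XX YY X'0 Y'0 SQ]]]; exists (X' `|` Y')%fset.
  apply/canonical_difference_set => //.
  by apply: contraNneq X'0 => /eqP; rewrite fsetU_eq0 => /andP[].
split; first exact: fsetUSS.
  have [x xX'] := fset0Pn _ X'0; apply/fset0Pn; exists x.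
  by rewrite in_fsetI in_fsetU xX' (fsubsetP XX).
have [y yY'] := fset0Pn _ Y'0; apply/fset0Pn; exists y.
by rewrite in_fsetI in_fsetU yY' orbT (fsubsetP YY).
Qed.

(** [copy_rel] depends only on the underlying maximal consistent sets, and each such set has a copy,
    so [canonical_Box] transfers to copies. *)
Lemma canonical_copy_Box m (s : world canonical_model) a :
  (forall t : world canonical_model, sat t a <-> sval t.1.1 a) ->
  (forall t : world canonical_model, copy_rel m t s -> sat t a) <->
  sval s.1.1 (Box m a).
Proof.
move=> IH; rewrite (canonical_Box _ _ (svalP s.1.1)).
split=> [h T TM TS|h t ts].
  exact/(IH (exist _ T TM, fset0, false))/h.
by apply/IH; apply: h ts; exact: svalP.
Qed.

Lemma truth_lemma a (s : world canonical_model) : sat s a <-> sval s.1.1 a.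
Proof.
have SP (t : copy) := mcs_propositional (svalP t.1.1).
elim: a s => [|p|a IH|a IHa b IHb|a IH|a IH|X Y] s.
- by split=> // _; exact: propT (SP s).
- by split=> /asboolP.
- by rewrite (propN (SP s)) -IH.
- by rewrite (propA (SP s)) -IHa -IHb.
- exact: (@canonical_copy_Box ModK).
- exact: (@canonical_copy_Box ModA).
- exact: canonical_Dg.
Qed.

(** If [a] is not derivable, [G] with [Neg a] extends to a maximal consistent set, any copy of which
    satisfies [G] and refutes [a]. *)
Lemma strong_completeness (G : form P V -> Prop) a : entails G a -> derives G a.
Proof.
move=> Ga; apply: contrapT => /consistent_extend/lindenbaum[S SM GS].
pose s : world canonical_model := (exist _ S SM, fset0, false).
have /(propN (mcs_propositional SM)) : S (Neg a) by apply: GS; right.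
apply; apply/(truth_lemma a s)/Ga => g Gg.
by apply/truth_lemma/GS; left.
Qed.

End Completeness.

Theorem mainTheorem8 (P V : countType) (Gamma : form P V -> Prop)
    (phi : form P V) :
  derives Gamma phi <-> entails Gamma phi.
Proof.
split=> [/derivesP[gs Ggs pphi] M s sG|]; last exact: strong_completeness.
have SP := sat_propositional s.
move/(propImp SP): (soundness pphi s); apply.
by apply/(prop_bigAnd SP) => g /Ggs/sG.
Qed.
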